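(* Let $\mathcal{A}$ be an algebra (containing the identity) of linear operators acting on the linear space $\mathbb{P}$ of real polynomials, and let $(p_n)_{n\ge 0}$ be a sequence of polynomials with $\deg p_n=n$. Assume that there are an operator $D_p\in\mathcal{A}$ and numbers $\theta_n$, $n\ge 0$, such that $D_p(p_n)=\theta_np_n$ for $n\ge 0$. Let $(\varepsilon_n)_n$ be a sequence of numbers which defines a $\mathcal{D}$-operator $\mathcal{D}$ of type 1 for $(p_n)_n$ and $\mathcal{A}$. Let $P_2$ be an arbitrary polynomial such that $P_2(\theta_n)\neq 0$ for $n\ge 0$, and let the sequences $(\gamma_n)_{n\ge 1}$ and $(\lambda_n)_{n\ge 0}$ satisfy $$\gamma_{n+1}=P_2(\theta_n)\ (n\ge 0),\qquad \lambda_n-\lambda_{n-1}=\gamma_n\ (n\ge 1).$$ Assume that there exists a polynomial $P_1$ such that $\lambda_n=P_1(\theta_n)$ for all $n\ge 0$. Define $q_0=1$ and $$q_n=p_n+\beta_np_{n-1},\qquad \beta_n=\varepsilon_n\frac{\gamma_{n+1}}{\gamma_n},\qquad n\ge 1.$$ Then the operator $$D_q=P_1(D_p)+\mathcal{D}\,P_2(D_p)$$ satisfies $D_q(q_n)=\lambda_nq_n$ for all $n\ge 0$. Moreover $D_q\in\mathcal{A}$.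
   Context: $\mathcal{D}$-operators of type 1: given the sequence $(p_n)_n$ with $\deg p_n=n$ and a sequence of numbers $(\varepsilon_n)_n$, let $\zeta:\mathbb{P}\to\mathbb{P}$ be the linear operator with $\zeta(p_n)=\varepsilon_np_{n-1}$ for $n\ge 0$ (with $p_{-1}=0$). Since $\zeta$ strictly lowers degree, the operator $\mathcal{D}:\mathbb{P}\to\mathbb{P}$, $$\mathcal{D}(p)=\sum_{j=1}^\infty(-1)^{j+1}\zeta^j(p),$$ is well defined (finite sum for each $p$). One says that $(\varepsilon_n)_n$ defines a $\mathcal{D}$-operator of type 1 for $(p_n)_n$ and $\mathcal{A}$ if $\mathcal{D}\in\mathcal{A}$. For a linear operator $T$ and a polynomial $P(x)=\sum_ja_jx^j$, $P(T)=\sum_ja_jT^j$; products of operators are compositions. *)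

(* Defs.v *)
From mathcomp Require Import all_boot all_order all_algebra.
From mathcomp Require Import boolp classical_sets fsbigop reals.

Set Implicit Arguments.
Unset Strict Implicit.
Unset Printing Implicit Defensive.
Import Order.TTheory GRing.Theory Num.Theory.
Local Open Scope ring_scope.

Section DOperators.
Variable R : realType.

(* Operators are bare functions, so that operators with the same values are
   equal; linearity is a predicate. *)
Definition operator : Type := {poly R} -> {poly R}.

Record operator_algebra (A : set operator) : Prop := OperatorAlgebra {
  opalg_linear : forall T, A T -> linear T;
  opalg_id : A idfun;
  opalg_add : forall S T, A S -> A T -> A (S \+ T);
  opalg_scale : forall (c : R) T, A T -> A (c \*: T);
  opalg_comp : forall S T, A S -> A T -> A (S \o T) }.

Definition poly_op (P : {poly R}) (T : operator) : operator :=
  fun f => \sum_(j < size P) P`_j *: iter j T f.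

(* For n = 0 the value is 0, by the convention p_(-1) = 0. *)
Definition zeta_spec (p : nat -> {poly R}) (eps : nat -> R) (zeta : operator) :
    Prop :=
  linear zeta /\
  forall n, zeta (p n) = if n is m.+1 then eps n *: p m else 0.

(* A sum over all j >= 1; the notation denotes the sum over the support of the
   summand, which is finite when zeta strictly lowers the degree. *)
Definition Dop1 (zeta : operator) : operator :=
  fun f => \sum_(j \in [set j : nat | (1 <= j)%N]%classic)
             (-1) ^+ j.+1 *: iter j zeta f.

End DOperators.

(* Main.v *)
Require Import Defs.
From mathcomp Require Import all_boot all_order all_algebra.
From mathcomp Require Import boolp classical_sets fsbigop reals.
From HB Require Import structures.
Import GRing.Theory.
Local Open Scope ring_scope.

(** The operator [D = Dop1 zeta] is zeta - zeta^2 + zeta^3 - ..., formally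
    zeta (1 + zeta)^-1, so D (f + zeta f) = zeta f for every f
    killed by a power of zeta ([Dop1_add_zeta]); each p_n is such an f.  Since
    P (D_p) multiplies p_n by P (theta_n) ([poly_op_eigen]), D_q maps
    q_n = p_n + beta_n p_(n-1) to
      lambda_n p_n + beta_n lambda_(n-1) p_(n-1)
        + D (gamma_(n+1) p_n + beta_n gamma_n p_(n-1)).
    The choice of beta_n makes beta_n gamma_n = gamma_(n+1) eps_n, so the
    argument of D is gamma_(n+1) (p_n + zeta p_n), whose image
    gamma_(n+1) eps_n p_(n-1) = beta_n gamma_n p_(n-1) raises the coefficient
    beta_n lambda_(n-1) to beta_n (lambda_(n-1) + gamma_n) = beta_n lambda_n.
    For n = 0 the constant 1 is a multiple of p_0, which D kills.  The algebra
    contains D_q because it contains every polynomial in D_p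
    ([poly_op_closed]). *)

Section Operators.
Set Implicit Arguments.
Unset Strict Implicit.
Variable R : realType.
Implicit Types (T zeta : {linear {poly R} -> {poly R}}) (f : {poly R}).

(** Gives access to the theory of linear maps for operators whose linearity is
    only a hypothesis. *)
Lemma linear_bundle (U : operator R) :
  linear U -> exists T, U = T :> operator R.
Proof.
move=> linU; pose T : {linear {poly R} -> {poly R}} :=
  HB.pack U (GRing.isLinear.Build R _ _ *:%R U linU).
by exists T.
Qed.

Lemma poly_op_eigen (P : {poly R}) T (a : R) f :
  T f = a *: f -> poly_op P T f = P.[a] *: f.
Proof.
move=> Tf; rewrite /poly_op horner_coef scaler_suml; apply: eq_bigr => j _.
have -> : iter j T f = a ^+ j *: f.
  elim: (j : nat) => [|k IHk]; first by rewrite expr0 scale1r.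
  by rewrite iterS IHk linearZ /= Tf scalerA exprSr.
by rewrite scalerA.
Qed.

Lemma poly_op_closed (A : set (operator R)) (P : {poly R}) (U : operator R) :
  operator_algebra A -> A U -> A (poly_op P U).
Proof.
move=> hA AU.
have Apow j : A (iter j U).
  elim: j => [|j IHj]; first exact: opalg_id hA.
  exact: opalg_comp hA _ _ AU IHj.
have A0 : A (fun=> 0).
  have := opalg_scale hA 0 (opalg_id hA).
  by congr A; apply/funext => f /=; rewrite scale0r.
rewrite /poly_op; elim: (size P) => [|n IHn].
  by have := A0; congr A; apply/funext => f; rewrite big_ord0.
have := opalg_add hA IHn (opalg_scale hA P`_n (Apow n)).
by congr A; apply/funext => f; rewrite big_ord_recr.
Qed.

Lemma iter_zero_le zeta f m n :
  (m <= n)%N -> iter m zeta f = 0 -> iter n zeta f = 0.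
Proof.
move=> /subnK <- zf; rewrite iterD zf.
by elim: (n - m)%N => //= k ->; rewrite linear0.
Qed.

(** On a vector killed by zeta^N the support of the summand is bounded, so the
    sum over its support is an ordinary finite sum. *)
Lemma Dop1_nilpotent zeta f N : iter N zeta f = 0 ->
  Dop1 zeta f = \sum_(j < N) (-1) ^+ j *: iter j.+1 zeta f.
Proof.
move=> zf; rewrite /Dop1 (@fsbigE _ _ _ _ _ (index_iota 1 N.+1)) ?iota_uniq //.
- rewrite big_mkcond big_add1 big_mkord; apply: eq_bigr => j _ /=.
  by rewrite mem_set // !exprS mulrA mulrNN !mul1r.
- by move=> j /=; rewrite mem_index_iota => /andP[].
- move=> j /= j_gt0; rewrite mem_index_iota j_gt0 -leqNgt => /ltnW leNj.
  by rewrite (iter_zero_le leNj zf) scaler0.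
Qed.

(** The geometric series telescopes: D (1 + zeta) = zeta wherever zeta is
    nilpotent. *)
Lemma Dop1_add_zeta zeta f N : iter N zeta f = 0 ->
  Dop1 zeta (f + zeta f) = zeta f.
Proof.
move=> zf.
have iter_add_zeta j : iter j zeta (f + zeta f) = iter j zeta f + iter j.+1 zeta f.
  by elim: j => //= j ->; rewrite linearD.
have zfS : iter N.+1 zeta f = 0 by rewrite iterS zf linear0.
rewrite (@Dop1_nilpotent _ _ N); last by rewrite iter_add_zeta zf zfS addr0.
transitivity (zeta f - (-1) ^+ N *: iter N.+1 zeta f); last first.
  by rewrite zfS scaler0 subr0.
elim: N {zf zfS} => [|N IHN]; first by rewrite big_ord0 expr0 scale1r subrr.
rewrite big_ord_recr /= IHN -!iterS iter_add_zeta scalerDr exprS mulN1r scaleNr opprK.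
by rewrite addrA subrK.
Qed.

(** The hypothesis of [Dop1_add_zeta] holds for p_n, which zeta sends down the
    chain p_n, p_(n-1), ..., p_0, 0 up to scalars. *)
Lemma iter_zeta_p (p : nat -> {poly R}) (eps : nat -> R) zeta n :
  zeta_spec p eps zeta -> iter n.+1 zeta (p n) = 0.
Proof.
move=> [_ zp]; elim: n => [|n IHn]; first by rewrite /= zp.
have iterZ m c f : iter m zeta (c *: f) = c *: iter m zeta f.
  by elim: m => //= m ->; rewrite linearZ.
by rewrite iterSr zp iterZ IHn scaler0.
Qed.

End Operators.

Theorem lemma3p1 (R : realType)
    (A : set (operator R)) (hA : operator_algebra A)
    (p : nat -> {poly R}) (hp : forall n, size (p n) = n.+1)
    (Dp : operator R) (hDp : A Dp)
    (theta : nat -> R) (htheta : forall n, Dp (p n) = theta n *: p n)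
    (eps : nat -> R)
    (zeta : operator R) (hzeta : zeta_spec p eps zeta)
    (hD : A (Dop1 zeta))
    (P2 : {poly R}) (hP2 : forall n, P2.[theta n] != 0)
    (gamma lambda : nat -> R)
    (hgamma : forall n, gamma n.+1 = P2.[theta n])
    (hlambda : forall n, lambda n.+1 - lambda n = gamma n.+1)
    (P1 : {poly R}) (hP1 : forall n, lambda n = P1.[theta n])
    (beta : nat -> R)
    (hbeta : forall n, beta n.+1 = eps n.+1 * (gamma n.+2 / gamma n.+1))
    (q : nat -> {poly R}) (hq0 : q 0%N = 1)
    (hq : forall n, q n.+1 = p n.+1 + beta n.+1 *: p n) :
  let Dq : operator R := poly_op P1 Dp \+ (Dop1 zeta \o poly_op P2 Dp) in
  (forall n, Dq (q n) = lambda n *: q n) /\ A Dq.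
Proof.
move=> Dq; split; last first.
  apply: (opalg_add hA (poly_op_closed P1 hA hDp)).
  exact: (opalg_comp hA hD (poly_op_closed P2 hA hDp)).
have [D DE] := linear_bundle (opalg_linear hA hD).
have [T TE] := linear_bundle (opalg_linear hA hDp).
have [Z ZE] := linear_bundle (proj1 hzeta).
(* The linearity of P (D_p) comes from its membership in the algebra. *)
have [L1 L1E] := linear_bundle
  (opalg_linear hA (poly_op_closed P1 hA hDp)).
have [L2 L2E] := linear_bundle
  (opalg_linear hA (poly_op_closed P2 hA hDp)).
have L1p n : L1 (p n) = lambda n *: p n.
  by rewrite -L1E TE hP1; apply: poly_op_eigen; rewrite -TE.
have L2p n : L2 (p n) = gamma n.+1 *: p n.
  by rewrite -L2E TE hgamma; apply: poly_op_eigen; rewrite -TE.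
have DqE f : Dq f = L1 f + D (L2 f) by rewrite /Dq /= L1E L2E DE.
have Zp n : iter n.+1 Z (p n) = 0.
  by apply: iter_zeta_p; rewrite -ZE; exact: hzeta.
have Dadd n : D (p n + Z (p n)) = Z (p n).
  by rewrite -DE ZE; exact: Dop1_add_zeta (Zp n).
have zp n : Z (p n) = if n is m.+1 then eps n *: p m else 0.
  by rewrite -ZE; exact: (proj2 hzeta).
case=> [|n]; rewrite DqE.
  (* The constant 1 is a multiple of p_0, and D p_0 = 0. *)
  have [c q0E] : exists c, q 0%N = c *: p 0%N.
    have /size_poly1P [a a0 p0E] : size (p 0%N) == 1%N by rewrite hp.
    by exists a^-1; rewrite hq0 p0E -mul_polyC -polyCM mulVf.
  have Dp0 : D (p 0%N) = 0 by have := Dadd 0%N; rewrite zp addr0.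
  rewrite q0E linearZ L1p linearZ L2p !linearZ /= Dp0 !scaler0 addr0.
  by rewrite !scalerA mulrC.
have gamma_neq0 : gamma n.+1 != 0 by rewrite hgamma.
have betaE : beta n.+1 * gamma n.+1 = gamma n.+2 * eps n.+1.
  by rewrite hbeta -mulrA divfK // mulrC.
have L2q : L2 (q n.+1) = gamma n.+2 *: (p n.+1 + Z (p n.+1)).
  by rewrite hq linearD linearZ /= !L2p zp scalerDr !scalerA betaE.
rewrite L2q linearZ /= Dadd zp scalerA -betaE hq linearD linearZ /= !L1p.
rewrite -addrA scalerA -scalerDl -mulrDr -hlambda subrKC.
by rewrite scalerDr scalerA [beta _ * _]mulrC.
Qed.
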